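(* Let $p$ be a prime and let $k$ be a field with $\operatorname{char} k=q$. (i) The minimal polynomial of the $p$-pertinent sequence is $$f(x)=\begin{cases} x^p-1 & \text{if } q\nmid p-1,\\ x^{p-1}+x^{p-2}+\cdots+x+1 & \text{if } q\mid p-1.\end{cases}$$ (ii) If $b_0=0$, $b_j=(-1)^{j+1}$ for $1\le j\le p-1$, and $b_p=b_{p+1}=\cdots=0$, then the sequence $$\Big\{B_n:=\sum_{j=0}^{n}\binom{n}{j}b_j\Big\}_{n\ge 1}$$ is the $p$-pertinent sequence.
   Context: Sequences $\{a_n\}$ are indexed by all integers $n\in\mathbb Z$ and are regarded as sequences in the base field $k$, which may have arbitrary characteristic. The $p$-pertinent sequence is the periodic sequence whose terms with $n\ge 1$ are $1,\ldots,1,0,1,\ldots,1,0,\ldots$ (blocks of $p-1$ ones followed by a zero), i.e. $a_n=1$ if $p\nmid n$ and $a_n=0$ if $p\mid n$; a periodic sequence is uniquely determined by its terms with $n\ge 1$. A sequence $\{a_n\}$ is linearly recursive if there is a non-zero polynomial $f(x)=f_0+f_1x+\cdots+f_mx^m\in k[x]$ such that $f_0a_n+f_1a_{n+1}+\cdots+f_ma_{n+m}=0$ for all integers $n$; in this case $\{a_n\}$ is said to satisfy $f(x)$. The minimal polynomial of a linearly recursive sequence is the monic polynomial of least degree that it satisfies.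
   Formalization: Part (ii) is proved only when char k = p: in any other characteristic it is false, since B_{p+1} = 1 − (−1)^{p−1}p must equal 1, which forces p = 0 in k (e.g. p = 2, k = Q gives B_n = n). *)

(* Defs.v *)
From mathcomp Require Import all_boot all_order all_algebra.

Set Implicit Arguments.
Unset Strict Implicit.
Unset Printing Implicit Defensive.

Import GRing.Theory.
Local Open Scope ring_scope.

(* [pchar k] only records prime characteristics: it is empty in characteristic
   zero, whence the separate second case. *)
Definition has_char (k : fieldType) (q : nat) : Prop :=
  q \in [pchar k] \/ (q = 0%N /\ [pchar k] =i pred0).

Definition satisfies (k : fieldType) (a : int -> k) (f : {poly k}) : Prop :=
  forall n : int, \sum_(i < size f) f`_i * a (n + i%:Z) = 0.

Definition linearly_recursive (k : fieldType) (a : int -> k) : Prop :=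
  exists2 f : {poly k}, f != 0 & satisfies a f.

(* The polynomial characterized here is unique, see [is_min_poly_uniq]. *)
Definition is_min_poly (k : fieldType) (a : int -> k) (f : {poly k}) : Prop :=
  [/\ linearly_recursive a, f \is monic, satisfies a f
    & forall g : {poly k}, g \is monic -> satisfies a g ->
        (size f <= size g)%N].

Definition pertinent (k : fieldType) (p : nat) (n : int) : k :=
  if (p%:Z %| n)%Z then 0 else 1.

Lemma satisfies_widen (k : fieldType) (a : int -> k) (f : {poly k}) (N : nat)
    (n : int) : (size f <= N)%N ->
  \sum_(i < size f) f`_i * a (n + i%:Z) = \sum_(i < N) f`_i * a (n + i%:Z).
Proof.
move=> leN; rewrite (big_ord_widen N (fun i => f`_i * a (n + i%:Z)) leN).
rewrite [LHS]big_mkcond; apply: eq_bigr => i _ /=; case: ltnP => // le_i.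
by rewrite nth_default ?mul0r.
Qed.

Lemma satisfies_scaleB (k : fieldType) (a : int -> k) (f g : {poly k}) (c : k) :
  satisfies a f -> satisfies a g -> satisfies a (c *: (f - g)).
Proof.
move=> fa ga n; pose N := maxn (size (c *: (f - g))) (maxn (size f) (size g)).
have [leh lef leg] : [/\ (size (c *: (f - g))%R <= N)%N, (size f <= N)%N
    & (size g <= N)%N] by rewrite /N !leq_max !leqnn !orbT.
rewrite (satisfies_widen a n leh).
transitivity (c * (\sum_(i < N) f`_i * a (n + i%:Z)
                   - \sum_(i < N) g`_i * a (n + i%:Z))).
  rewrite -sumrB mulr_sumr; apply: eq_bigr => i _.
  by rewrite coefZ coefB -mulrBl mulrA.
by rewrite -(satisfies_widen a n lef) -(satisfies_widen a n leg) fa ga subr0 mulr0.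
Qed.

Lemma is_min_poly_uniq (k : fieldType) (a : int -> k) (f g : {poly k}) :
  is_min_poly a f -> is_min_poly a g -> f = g.
Proof.
move=> [_ mf fa minf] [_ mg ga ming]; apply/eqP; rewrite -subr_eq0.
apply/negPn/negP => nz; pose h := (lead_coef (f - g))^-1 *: (f - g).
have nzc : (lead_coef (f - g))^-1 != 0 by rewrite invr_eq0 lead_coef_eq0.
have mh : h \is monic by rewrite monicE lead_coefZ mulVf // lead_coef_eq0.
have := minf h mh (satisfies_scaleB _ fa ga); rewrite size_scale //.
have sfg : size f = size g by apply/eqP; rewrite eqn_leq minf // ming.
have f0 : (0 < size f)%N by rewrite size_poly_gt0 monic_neq0.
rewrite leqNgt => /negP[]; rewrite -(prednK f0) ltnS; apply/leq_sizeP => i.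
rewrite leq_eqVlt => /predU1P[<-|lt_i]; rewrite coefB.
  by rewrite -lead_coefE [in X in _ - X]sfg -lead_coefE (eqP mf) (eqP mg) subrr.
by rewrite !nth_default ?subrr // -?sfg -(prednK f0).
Qed.

(* Main.v *)
Require Import Defs.
From mathcomp Require Import all_boot all_order all_algebra.

Set Implicit Arguments.
Unset Strict Implicit.
Unset Printing Implicit Defensive.

Import GRing.Theory.
Local Open Scope ring_scope.

(** The pertinent sequence is the constant sequence 1 minus the indicator of the
    multiples of $p$. A window of $p$ consecutive indices contains exactly one
    multiple of $p$, so for a polynomial $g$ of degree less than $p$ the
    recurrence at $n$ reads $g(1) - g_j = 0$, where $n + j$ is that multiple
    ([sum_pertinent]). As $n$ varies, $j$ takes every value below $p$: the
    polynomials of degree less than $p$ satisfied by the sequence are the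
    multiples $c (1 + x + \dots + x^{p-1})$ with $c = g(1) = p c$
    ([satisfies_pertinent_small]). A non-zero one exists exactly when $p - 1$
    vanishes in $k$, and it then has degree $p - 1$; otherwise $x^p - 1$, which
    expresses the $p$-periodicity, has the least possible degree.

    For the second part, the partial alternating sum
    $\sum_{j<p} (-1)^j \binom{n}{j} = (-1)^{p-1} \binom{n-1}{p-1}$
    turns $B_n$ into $1 - (-1)^{p-1} \binom{n-1}{p-1}$. In characteristic $p$
    this binomial coefficient is $0$ if $p \nmid n$, because
    $n \binom{n-1}{p-1} = p \binom{n}{p}$, and $(-1)^{p-1}$ if $p \mid n$, because
    $(n-1) \cdots (n-p+1)$ is then congruent to $(-1)^{p-1} (p-1)!$. *)

(** Characteristic zero needs no exception: both sides then say that n is zero.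
    The condition on $q$ thereby becomes the vanishing of $p - 1$ in $k$, the
    form in which it arises from the recurrence. *)
Lemma has_char_dvd (k : fieldType) (q n : nat) :
  has_char k q -> (q %| n)%N = (n%:R == 0 :> k).
Proof.
case=> [chq|[-> ch0]]; first exact: dvdn_pcharf.
by rewrite dvd0n; have /pcharf0P-> := ch0.
Qed.

Lemma dvdz_window (p : nat) (n : int) (i j : 'I_p) :
  (p%:Z %| n + j%:Z)%Z -> (p%:Z %| n + i%:Z)%Z = (i == j).
Proof.
move=> pj; have -> : n + i%:Z = (n + j%:Z) + (i%:Z - j%:Z).
  by rewrite addrACA [j%:Z + _]addrC addrA subrK.
by rewrite rpredDl // -eqz_mod_dvd !modz_nat eqz_nat !modn_small.
Qed.

Lemma window_multiple (p : nat) (n : int) : (0 < p)%N ->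
  exists j : 'I_p, (p%:Z %| n + j%:Z)%Z.
Proof.
move=> p_gt0; have p0 : p%:Z != 0 by rewrite eqz_nat -lt0n.
have := ltz_pmod (- n) (p_gt0 : 0 < p%:Z); have := modz_ge0 (- n) p0.
case def_j: (- n %% p%:Z)%Z => [j|//] _; rewrite ltz_nat => lt_jp.
exists (Ordinal lt_jp); by rewrite /= -def_j -rpredN opprD -eqz_mod_dvd modz_mod.
Qed.

(** The recurrence operator in closed form: the only term lost from the full sum
    is the one at the unique multiple of $p$ in the window. *)
Lemma sum_pertinent (k : fieldType) (p : nat) (F : nat -> k) (n : int)
    (j : 'I_p) : (p%:Z %| n + j%:Z)%Z ->
  \sum_(i < p) F i * pertinent k p (n + i%:Z) = \sum_(i < p) F i - F j.
Proof.
move=> pj; rewrite [in RHS](bigD1 j) //= [RHS]addrC addKr (bigD1 j) //=.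
rewrite /pertinent pj mulr0 add0r; apply: eq_bigr => i ne_ij.
by rewrite (dvdz_window i pj) (negPf ne_ij) mulr1.
Qed.

Lemma sum_XnE (R : nzSemiRingType) (n : nat) :
  \sum_(0 <= i < n) 'X^i = \poly_(i < n) 1 :> {poly R}.
Proof. by rewrite poly_def big_mkord; apply: eq_bigr => i _; rewrite scale1r. Qed.

Lemma size_sum_Xn (R : nzSemiRingType) (n : nat) :
  size (\sum_(0 <= i < n) 'X^i : {poly R}) = n.
Proof.
case: n => [|n]; first by rewrite big_geq ?size_poly0.
by rewrite sum_XnE size_poly_eq ?oner_eq0.
Qed.

Lemma monic_sum_Xn (R : nzSemiRingType) (n : nat) : (0 < n)%N ->
  \sum_(0 <= i < n) 'X^i \is @monic R.
Proof. by move=> n_gt0; rewrite sum_XnE monicE lead_coef_poly ?oner_eq0. Qed.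

(** This is the $p$-periodicity of the sequence. *)
Lemma satisfies_pertinent_Xp_sub1 (k : fieldType) (p : nat) : (0 < p)%N ->
  satisfies (pertinent k p) ('X^p - 1).
Proof.
case: p => // p _ n; rewrite size_XnsubC // big_ord_recr big_ord_recl /=.
rewrite big1 => [|i _]; rewrite !coefB !coefXn !coef1 /=.
  rewrite /pertinent eqxx sub0r !subr0 addr0 mulN1r mul1r rpredDr ?dvdzz //.
  by rewrite addNr.
by rewrite eqSS ltn_eqF // subrr mul0r.
Qed.

(** Any $p$ consecutive terms consist of $p - 1$ ones and a single zero. *)
Lemma satisfies_pertinent_geometric (k : fieldType) (p : nat) :
  (0 < p)%N -> (p - 1)%:R = 0 :> k ->
  satisfies (pertinent k p) (\sum_(0 <= i < p) 'X^i).
Proof.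
move=> p_gt0 p1 n; rewrite size_sum_Xn sum_XnE.
have [j pj] := window_multiple n p_gt0.
rewrite (sum_pertinent (fun i => (\poly_(i < p) 1 : {poly k})`_i) pj).
under eq_bigr => i _ do rewrite coef_poly ltn_ord.
by rewrite coef_poly ltn_ord sumr_const card_ord -[1]/(1%:R) -natrB.
Qed.

(** Taking $n = -j$ in the recurrence isolates the coefficient $g_j$. *)
Lemma satisfies_pertinent_small (k : fieldType) (p : nat) (g : {poly k}) :
  (size g <= p)%N -> satisfies (pertinent k p) g ->
  forall j, (j < p)%N -> g`_j = g.[1].
Proof.
move=> le_gp sat j lt_jp; have := sat (- j%:Z).
have pj : (p%:Z %| - j%:Z + (Ordinal lt_jp : nat)%:Z)%Z by rewrite addNr dvdz0.
rewrite (satisfies_widen _ _ le_gp) (sum_pertinent (fun i => g`_i) pj) /=.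
move/eqP; rewrite subr_eq0 => /eqP <-.
rewrite (horner_coef_wide _ le_gp); apply: eq_bigr => i _.
by rewrite expr1n mulr1.
Qed.

(** Both cases of the minimality claim at once: the boolean is the extra degree
    forced when $p - 1$ is non-zero in $k$. If the degree of $g$ is less than
    $p$, all its coefficients below $p$ equal $g(1)$. This value is non-zero
    because $g$ is, so the coefficient at $p - 1$ gives the bound on the size,
    while adding up the $p$ coefficients gives $p g(1) = g(1)$. *)
Lemma min_size_pertinent (k : fieldType) (p : nat) (g : {poly k}) :
  (0 < p)%N -> g != 0 -> satisfies (pertinent k p) g ->
  (p + ((p - 1)%:R != 0 :> k)%R <= size g)%N.
Proof.
move=> p_gt0 g0 sat; have [lt_pg|le_gp] := ltnP p (size g).
  by apply: leq_trans lt_pg; rewrite -[X in (_ <= X)%N]addn1 leq_add2l leq_b1.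
have coefg := satisfies_pertinent_small le_gp sat.
have g1 : g.[1] != 0.
  apply: contra g0 => /eqP g10; apply/eqP/polyP => i; rewrite coef0.
  by have [/coefg->|/(leq_trans le_gp)/(nth_default (0 : k))] := ltnP i p.
have -> : (p - 1)%:R = 0 :> k.
  have: g.[1] *+ p = g.[1].
    rewrite [RHS](horner_coef_wide _ le_gp) -[in LHS](card_ord p) -sumr_const.
    by apply: eq_bigr => i _; rewrite coefg // expr1n mulr1.
  rewrite -mulr_natr -[RHS]mulr1 => /(mulfI g1).
  by rewrite natrB // => ->; rewrite subrr.
rewrite eqxx addn0 leqNgt; apply: contra g1 => lt_gp.
by rewrite -(coefg p.-1) ?prednK // nth_default // -ltnS prednK.
Qed.

Lemma sum_nat_truncate (V : nmodType) (F : nat -> V) (m n : nat) :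
  (forall j, (minn m n <= j)%N -> F j = 0) ->
  \sum_(0 <= j < m) F j = \sum_(0 <= j < n) F j.
Proof.
wlog le_mn : m n / (m <= n)%N => [th F0|].
  have [/th->//|/ltnW/th th'] := leqP m n.
  by rewrite th' // => j; rewrite minnC; apply: F0.
move/minn_idPl: (le_mn) => -> F0; rewrite [RHS](big_cat_nat _ le_mn) //=.
rewrite [X in _ + X]big_nat_cond [X in _ + X]big1 ?addr0 // => j.
by rewrite andbT => /andP[/F0].
Qed.

(** By Pascal's rule the sum telescopes. *)
Lemma sum_alternating_binomial (R : pzRingType) (n m : nat) :
  \sum_(0 <= j < m.+1) (-1) ^+ j * 'C(n.+1, j)%:R = (-1) ^+ m * 'C(n, m)%:R :> R.
Proof.
elim: m => [|m IHm]; first by rewrite big_nat1 !bin0.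
by rewrite big_nat_recr //= IHm binS natrD mulrDr exprS !mulN1r !mulNr addrC subrK.
Qed.

Lemma bin_pred_pchar_ndvd (k : fieldType) (p n : nat) :
  p \in [pchar k] -> ~~ (p %| n.+1)%N -> 'C(n, p.-1)%:R = 0 :> k.
Proof.
move=> chp; rewrite (dvdn_pcharf chp) => n0; apply/eqP.
rewrite -(mulrI_eq0 _ (mulfI n0)) -natrM.
have -> : (n.+1 * 'C(n, p.-1) = p * 'C(n.+1, p))%N.
  by rewrite mul_bin_diag prednK // prime_gt0 // (pcharf_prime chp).
by rewrite natrM (pcharf0 chp) mul0r.
Qed.

(** Multiplying by $(p-1)!$ turns the binomial coefficient into the falling
    factorial of n, whose factors $n - i$ are $-(i+1)$ in $k$ because $n + 1$
    vanishes there. By Wilson's theorem $(p-1)!$ is $-1$ in $k$, hence can be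
    cancelled. *)
Lemma bin_pred_pchar_dvd (k : fieldType) (p n : nat) :
  p \in [pchar k] -> (p %| n.+1)%N -> 'C(n, p.-1)%:R = (-1) ^+ p.-1 :> k.
Proof.
move=> chp pn; have p_gt0 := prime_gt0 (pcharf_prime chp).
have p_gt1 := prime_gt1 (pcharf_prime chp).
have fact_neg1 : (p.-1)`!%:R = -1 :> k.
  apply/eqP; rewrite -addr_eq0 natr1 -(dvdn_pcharf chp) -Wilson //.
  exact: (pcharf_prime chp).
have bin_fact : 'C(n, p.-1)%:R * (p.-1)`!%:R = (-1) ^+ p.-1 * (p.-1)`!%:R :> k.
  rewrite -natrM bin_ffact ffact_prod natr_prod.
  rewrite fact_prod big_add1 big_mkord natr_prod -[X in (-1) ^+ X](card_ord p.-1) -prodrN.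
  apply: eq_bigr => i _; apply/eqP; rewrite -addr_eq0 -natrD addnS subnK.
    by rewrite -(dvdn_pcharf chp).
  have := dvdn_leq (ltn0Sn n) pn; have := ltn_ord i; rewrite -ltnS prednK //.
  by move=> lt_ip le_pn; rewrite -ltnS (leq_trans _ le_pn) // ltnW.
by move: bin_fact; rewrite fact_neg1 => /(mulIf _)-> //; rewrite oppr_eq0 oner_eq0.
Qed.

Theorem lemma2p8 (p q : nat) (k : fieldType)
    (p_prime : prime p) (char_k : has_char k q) :
  is_min_poly (pertinent k p)
    (if (q %| p - 1)%N then \sum_(0 <= i < p) 'X^i else 'X^p - 1)
  /\
  (q = p ->
   forall b : nat -> k,
     b 0%N = 0 ->
     (forall j : nat, (1 <= j <= p - 1)%N -> b j = (-1) ^+ j.+1) ->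
     (forall j : nat, (p <= j)%N -> b j = 0) ->
     forall n : nat, (1 <= n)%N ->
       \sum_(0 <= j < n.+1) 'C(n, j)%:R * b j = pertinent k p n%:Z).
Proof.
have p_gt0 := prime_gt0 p_prime; split.
  rewrite (has_char_dvd _ char_k).
  have [p1|p1] := eqVneq (p - 1)%:R (0 : k).
    have sat := satisfies_pertinent_geometric p_gt0 p1.
    have mon := monic_sum_Xn k p_gt0.
    split=> // [|g mg sg]; first by exists (\sum_(0 <= i < p) 'X^i); rewrite ?monic_neq0.
    rewrite size_sum_Xn; apply: leq_trans (min_size_pertinent p_gt0 (monic_neq0 mg) sg).
    exact: leq_addr.
  have sat := satisfies_pertinent_Xp_sub1 k p_gt0.
  have mon : 'X^p - 1 \is @monic k by exact: monicXnsubC.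
  split=> // [|g mg sg]; first by exists ('X^p - 1); rewrite ?monic_neq0.
  have := min_size_pertinent p_gt0 (monic_neq0 mg) sg.
  by rewrite p1 addn1 size_XnsubC.
move=> q_p b b0 b_small b_large n n_gt0.
have chp : p \in [pchar k].
  case: char_k => [|[q0]]; first by rewrite q_p.
  by move: p_gt0; rewrite -q_p q0.
have alt_sum : \sum_(0 <= j < n.+1) 'C(n, j)%:R * b j
    = 1 - \sum_(0 <= j < p) (-1) ^+ j * 'C(n, j)%:R.
  (* The terms vanish for j > n through the binomial, for j >= p through b. *)
  rewrite (@sum_nat_truncate _ _ n.+1 p) => [|j]; last first.
    rewrite geq_min => /orP[lt_nj|le_pj]; last by rewrite b_large ?mulr0.
    by rewrite bin_small ?mul0r.
  rewrite !(big_ltn p_gt0) b0 mulr0 bin0 add0r mulr1 opprD addrA subrr sub0r.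
  rewrite -sumrN; apply: eq_big_nat => j /andP[j_gt0 lt_jp].
  have le_jp : (1 <= j <= p - 1)%N by rewrite j_gt0 subn1 -ltnS prednK.
  by rewrite b_small // exprS mulN1r mulrN mulrC.
rewrite alt_sum -{1}(prednK p_gt0) -(prednK n_gt0) sum_alternating_binomial.
rewrite /pertinent dvdzE !absz_nat.
have [pn|pn] := boolP (p %| n.-1.+1)%N.
  by rewrite bin_pred_pchar_dvd // -expr2 sqrr_sign subrr.
by rewrite bin_pred_pchar_ndvd // mulr0 subr0.
Qed.
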